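(* Let $\rho\in\mathcal C$. For every $n\ge1$ let $\pi_n$ be a random permutation in $S_n$ with law $\mathbb P_n$ such that for every positive integer $l$, \[ \lim_{n\to\infty}\sup_{\mathbf p,\mathbf q\in\mathcal S(n,l)}\left|\frac{n^l\,\mathbb P_n(\pi_n(\mathbf p)=\mathbf q)}{\prod_{a=1}^l\rho\left(\frac{p_a}{n},\frac{q_a}{n}\right)}-1\right|=0. \] For $a\ge1$ let $C_n(a)$ be the number of cycles of length $a$ of $\pi_n$, and let \[ c_\rho(a)=\frac1a\int_{[0,1]^a}\rho(x_1,x_2)\rho(x_2,x_3)\cdots\rho(x_{a-1},x_a)\rho(x_a,x_1)\,dx_1\cdots dx_a. \] Then for every $l\in\mathbb N$ and every $(k_1,\dots,k_l)\in\mathbb N^l$, \[ \lim_{n\to\infty}\mathbb E\prod_{a=1}^l C_n(a)^{k_a}=\prod_{a=1}^l\mathbb E\,\mathrm{Poi}(c_\rho(a))^{k_a}. \] In particular $(C_n(1),\dots,C_n(l))$ converges in distribution to $(\mathrm{Poi}(c_\rho(1)),\dots,\mathrm{Poi}(c_\rho(l)))$ with mutually independent coordinates.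
   Context: $[n]=\{1,\dots,n\}$. $\mathcal S(n,l)=\{\mathbf p=(p_1,\dots,p_l)\in[n]^l: p_a\ne p_b \text{ for } a\ne b\}$; for a permutation $\pi_n$, $\pi_n(\mathbf p)=(\pi_n(p_1),\dots,\pi_n(p_l))$. $\mathcal C$ is the set of strictly positive continuous functions $\rho$ on $[0,1]^2$ with $\int_0^1\rho(x,y)\,dx=\int_0^1\rho(x,y)\,dy=1$ for all $x,y$. $\mathrm{Poi}(\lambda)$ denotes a Poisson random variable with mean $\lambda$. *)

(* Defs.v *)
From HB Require Import structures.
From mathcomp Require Import all_boot all_order all_algebra all_fingroup.
From mathcomp Require Import all_classical all_reals all_analysis.
Set Implicit Arguments. Unset Strict Implicit. Unset Printing Implicit Defensive.
Import Order.TTheory GRing.Theory Num.Theory.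
Import numFieldNormedType.Exports.
Local Open Scope classical_set_scope.
Local Open Scope ring_scope.

Definition int01 {R : realType} (f : R -> R) : R :=
  Rintegral (@lebesgue_measure R) `[0%R, 1%R] f.

(* The class C: strictly positive continuous functions on [0,1]^2 with both
   marginals equal to 1 (values of rho outside [0,1]^2 are irrelevant). *)
Definition classC {R : realType} (rho : R -> R -> R) : Prop :=
  [/\ (forall x y, x \in `[0%R, 1%R] -> y \in `[0%R, 1%R] -> 0 < rho x y),
      {within `[0%R, 1%R] `*` `[0%R, 1%R], continuous (fun p : R * R => rho p.1 p.2)},
      (forall y, y \in `[0%R, 1%R] -> int01 (fun x => rho x y) = 1) &
      (forall x, x \in `[0%R, 1%R] -> int01 (fun y => rho x y) = 1)].

(* Iterated integral over [0,1]^m of f : (nat -> R) -> R, where coordinate 0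
   is the outermost integration variable and coordinates >= m are set to 0. *)
Fixpoint iterint {R : realType} (m : nat) (f : (nat -> R) -> R) : R :=
  match m with
  | 0 => f (fun _ => 0)
  | m'.+1 => int01 (fun x =>
      iterint m' (fun v => f (fun i => if i is i'.+1 then v i' else x)))
  end.

Definition c_rho {R : realType} (rho : R -> R -> R) (a : nat) : R :=
  a%:R^-1 * iterint a (fun x => \prod_(i < a) rho (x i) (x ((i.+1) %% a)%N)).

Definition prob_map {R : realType} (n l : nat) (P : {perm 'I_n} -> R)
  (p q : {ffun 'I_l -> 'I_n}) : R :=
  \sum_(s : {perm 'I_n} | [forall a, s (p a) == q a]) P s.

(* sup over p, q in S(n,l) of | n^l P_n(pi_n(p)=q) / prod rho(p_a/n, q_a/n) - 1 |
   (points of [n] are 1..n, i.e. p_a = val (p a) + 1). *)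
Definition sup_dev {R : realType} (rho : R -> R -> R) (n l : nat)
  (P : {perm 'I_n} -> R) : R :=
  \big[Num.max/0]_(p : {ffun 'I_l -> 'I_n} | injectiveb p)
   \big[Num.max/0]_(q : {ffun 'I_l -> 'I_n} | injectiveb q)
     `| (n%:R ^+ l * prob_map P p q) /
        (\prod_(a < l) rho ((val (p a)).+1%:R / n%:R) ((val (q a)).+1%:R / n%:R))
        - 1 |.

Definition ncycles (n : nat) (s : {perm 'I_n}) (a : nat) : nat :=
  #|[set c in porbits s | #|c| == a]|.

Definition poisson_moment {R : realType} (lam : R) (k : nat) : R :=
  limn (fun N => \sum_(0 <= j < N) ((j%:R : R) ^+ k * poisson_pmf lam j)).

(* Main.v *)
Require Import Defs.
From HB Require Import structures.
From mathcomp Require Import all_boot all_order all_algebra all_fingroup.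
From mathcomp Require Import all_classical all_reals all_analysis.
From mathcomp Require Import ring lra.
Set Implicit Arguments. Unset Strict Implicit. Unset Printing Implicit Defensive.
Import Order.TTheory GRing.Theory Num.Theory.
Import numFieldNormedType.Exports.
Local Open Scope classical_set_scope.
Local Open Scope ring_scope.

(** The number of injections of a disjoint union of cycles of prescribed lengths
    into [n] that intertwine the cyclic shift with pi_n is, up to the factor
    prod_a a^{m_a}, the product of the falling factorials (C_n(a))_{m_a}.  The
    hypothesis on pi_n turns its expectation into a Riemann sum of a product of
    values of rho along these cycles (non-injective maps contribute O(1/n)), so the
    joint factorial moments of the cycle counts converge to prod_a c_rho(a)^{m_a}.
    Coordinates are then replaced one at a time, the others acting as a nonnegative
    weight: a power x^k is a combination of falling factorials, and the indicator of
    {x = j} is squeezed between partial sums of its Bonferroni expansion. *)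

(** * Bonferroni expansion of a point mass *)

Lemma cvgnM (R : realType) (k l : R) (u v : nat -> R) :
  u @ \oo --> k -> v @ \oo --> l -> (fun n => u n * v n) @ \oo --> k * l.
Proof. by move=> uk vl; apply: cvgM. Qed.

Lemma cvgn_cstM (R : realType) (c l : R) (u : nat -> R) :
  u @ \oo --> l -> (fun n => c * u n) @ \oo --> c * l.
Proof. by apply: cvgnM; exact: cvg_cst. Qed.

Lemma cvgn_Mcst (R : realType) (c l : R) (u : nat -> R) :
  u @ \oo --> l -> (fun n => u n * c) @ \oo --> l * c.
Proof. by move=> ul; apply: cvgnM => //; exact: cvg_cst. Qed.

Lemma ffactnD (x j m : nat) : (x ^_ (j + m) = x ^_ j * (x - j) ^_ m)%N.
Proof.
elim: m => [|m IH]; first by rewrite addn0 ffactn0 muln1.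
by rewrite addnS !ffactnSr IH -mulnA subnDA.
Qed.

(** By Pascal's rule the alternating partial sums of a nonzero row telescope to a single signed
    entry of the row above, which Pascal's rule again bounds by ['C(y, M)]. *)
Lemma alternating_binomial_bound (R : realType) (y M : nat) :
  `| (y == 0)%:R - \sum_(0 <= m < M) (-1) ^+ m * ('C(y, m))%:R | <= ('C(y, M))%:R :> R.
Proof.
case: y => [|y].
  case: M => [|M]; first by rewrite big_geq// subr0 normr1.
  rewrite big_nat_recl//= big1_seq ?addr0 ?bin0 ?mulr1 ?expr0 ?subrr ?normr0//.
  by move=> i _; rewrite bin0n mulr0.
case: M => [|M]; first by rewrite big_geq// subr0 normr0 bin0.
suff -> : \sum_(0 <= m < M.+1) (-1) ^+ m * ('C(y.+1, m))%:R = (-1) ^+ M * ('C(y, M))%:R :> R.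
  rewrite sub0r normrN normrM normrX normrN1 expr1n mul1r normr_nat ler_nat.
  by rewrite binS leq_addl.
elim: M => [|M IH]; first by rewrite big_nat1 !bin0.
by rewrite big_nat_recr//= IH binS natrD exprS; ring.
Qed.

(** Since [x ^_ (j + m) / (j! m!) = 'C(x, j) 'C(x - j, m)], everything is ['C(x, j)] times the
    alternating bound at [y = x - j]; for [x < j] this factor kills both sides. *)
Lemma pointmass_bonferroni (R : realType) (x j M : nat) :
  `| (x == j)%:R - \sum_(0 <= m < M) (-1) ^+ m / (j`! * m`!)%:R * (x ^_ (j + m))%:R |
    <= (x ^_ (j + M))%:R / (j`! * M`!)%:R :> R.
Proof.
have E m : (x ^_ (j + m))%:R / (j`! * m`!)%:R = ('C(x, j))%:R * ('C(x - j, m))%:R :> R.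
  have nz k : (k`!)%:R != 0 :> R by rewrite pnatr_eq0 -lt0n fact_gt0.
  by rewrite ffactnD -!bin_ffact !natrM; field; rewrite !nz.
rewrite E; under eq_bigr do rewrite mulrAC -mulrA E mulrCA.
rewrite -mulr_sumr.
have [xj|jx] := ltnP x j.
  by rewrite bin_small// !mul0r subr0 (ltn_eqF xj) normr0.
have -> : (x == j)%:R = ('C(x, j))%:R * (x - j == 0)%N%:R :> R.
  rewrite subn_eq0 eqn_leq jx andbT; case: leqP => xj; last by rewrite mulr0.
  by rewrite (_ : x = j) ?binn ?mulr1//; apply/eqP; rewrite eqn_leq xj jx.
rewrite -mulrBr normrM normr_nat ler_wpM2l//.
exact: alternating_binomial_bound.
Qed.

(** * From factorial moments to other statistics *)

Section Transfer.
Context {R : realType}.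

(** The weight [w] is not normalised and need not be a probability: this is what allows
    treating the coordinates of a random vector one after the other. *)
Definition transfers (lam : R) (g : nat -> R) (v : R) : Prop :=
  forall (S : nat -> finType) (X : forall n, S n -> nat) (w : forall n, S n -> R) (kappa : R),
  (forall n s, 0 <= w n s) ->
  (forall m, (fun n => \sum_(s : S n) w n s * (X n s ^_ m)%:R) @ \oo --> kappa * lam ^+ m) ->
  (fun n => \sum_(s : S n) w n s * g (X n s)) @ \oo --> kappa * v.

(** Terms with [j < m] vanish, and reindexing by [j = i + m] leaves [lam ^+ m * expR (- lam)] times
    the exponential series. *)
Lemma poisson_ffact_moment (lam : R) (m : nat) : 0 < lam ->
  (fun N => \sum_(0 <= j < N) (j ^_ m)%:R * poisson_pmf lam j) @ \oo --> lam ^+ m.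
Proof.
move=> lam0; rewrite -(cvg_shiftn m).
have -> : (fun N => \sum_(0 <= j < N + m) (j ^_ m)%:R * poisson_pmf lam j) =
          (fun N => lam ^+ m * expR (- lam) * series (exp_coeff lam) N).
  apply/funext => N; rewrite (@big_cat_nat _ _ _ m) ?leq_addl//=.
  rewrite big_nat_cond big1 ?add0r => [|j /andP[/andP[_ jm] _]]; last by rewrite ffact_small// mul0r.
  rewrite -[X in index_iota X]add0n big_addn addnK /series/= mulr_sumr.
  apply: eq_bigr => i _; rewrite /poisson_pmf lam0 /exp_coeff/=.
  have -> : (i + m)`!%:R = ((i + m) ^_ m)%:R * i`!%:R :> R.
    by have := ffact_fact (leq_addl i m); rewrite addnK -natrM => ->.
  have h1 : ((i + m) ^_ m)%:R != 0 :> R by rewrite pnatr_eq0 -lt0n ffact_gt0 leq_addl.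
  have h2 : (i`!)%:R != 0 :> R by rewrite pnatr_eq0 -lt0n fact_gt0.
  by rewrite exprD; field; rewrite h1 h2.
have lE : lam ^+ m = lam ^+ m * expR (- lam) * expR lam.
  by rewrite -mulrA -expRD addNr expR0 mulr1.
rewrite [in X in _ --> X]lE; apply: cvgn_cstM; exact: is_cvg_series_exp_coeff.
Qed.

Lemma transfers_moment (lam : R) (k : nat) : 0 < lam ->
  transfers lam (fun x => x%:R ^+ k) (poisson_moment lam k).
Proof.
move=> lam0.
(* The extra factor [x ^_ m] makes the induction on [k] close. One and the same [v] has to serve for
   the Poisson series and for the transferred limit, so both facts are carried together; [m = 0] is
   the claim. *)
suff H m : exists v,
    (fun N => \sum_(0 <= j < N) (j%:R ^+ k * (j ^_ m)%:R) * poisson_pmf lam j) @ \oo --> v /\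
    transfers lam (fun x => x%:R ^+ k * (x ^_ m)%:R) v.
  have [v [cv tv]] := H 0.
  have E : (fun x : nat => x%:R ^+ k * (x ^_ 0)%:R : R) = (fun x => x%:R ^+ k).
    by apply/funext => x; rewrite ffactn0 mulr1.
  move: tv; rewrite E => tv; rewrite /poisson_moment.
  suff -> : limn (fun N => \sum_(0 <= j < N) (j%:R ^+ k * poisson_pmf lam j)) = v by [].
  apply/cvg_lim => //; move: cv; apply: cvg_trans; apply: near_eq_cvg; near=> N.
  by apply: eq_bigr => j _; rewrite ffactn0 mulr1.
elim: k m => [|k IH] m.
  exists (lam ^+ m); split.
    by under eq_fun do under eq_bigr do rewrite expr0 mul1r; exact: poisson_ffact_moment.
  by move=> S X w kappa w0 /(_ m); under [in X in _ -> X]eq_fun do under eq_bigr do rewrite expr0 mul1r.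
(* From [x * x ^_ m = x ^_ m.+1 + m * x ^_ m]: the power drops by one, at the price of a higher
   falling factorial. *)
have E (x : nat) : x%:R ^+ k.+1 * (x ^_ m)%:R =
    x%:R ^+ k * (x ^_ m.+1)%:R + m%:R * (x%:R ^+ k * (x ^_ m)%:R) :> R.
  rewrite exprSr ffactnSr natrM.
  have [mx|xm] := leqP m x; first by rewrite natrB//; ring.
  by rewrite ffact_small// !(mulr0,mul0r) addr0.
have [v1 [c1 t1]] := IH m.+1; have [v2 [c2 t2]] := IH m.
exists (v1 + m%:R * v2); split.
  under eq_fun do (under eq_bigr do rewrite E mulrDl -[X in _ + X]mulrA; rewrite big_split -mulr_sumr).
  by apply: cvgD => //; apply: cvgn_cstM.
move=> S X w kappa w0 Hw.
under eq_fun do (under eq_bigr do rewrite E mulrDr [X in _ + X]mulrCA; rewrite big_split -mulr_sumr).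
by rewrite mulrDr [X in _ + X]mulrCA; apply: cvgD; [exact: t1|apply: cvgn_cstM; exact: t2].
Unshelve. all: by end_near. Qed.

Lemma transfers_pmf (lam : R) (j : nat) : 0 < lam ->
  transfers lam (fun x => (x == j)%:R) (poisson_pmf lam j).
Proof.
move=> lam0 S X w kappa w0 Hw.
pose a m : R := (-1) ^+ m / (j`! * m`!)%:R.
pose A M n : R := \sum_(0 <= m < M) a m * \sum_(s : S n) w n s * (X n s ^_ (j + m))%:R.
pose B M n : R := (\sum_(s : S n) w n s * (X n s ^_ (j + M))%:R) / (j`! * M`!)%:R.
have AB M n : `| \sum_(s : S n) w n s * (X n s == j)%:R - A M n | <= B M n.
  rewrite /A; under [X in _ - X]eq_bigr do rewrite mulr_sumr.
  rewrite exchange_big -sumrB /B mulr_suml (le_trans (ler_norm_sum _ _ _))//.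
  apply: ler_sum => s _; under [X in _ - X]eq_bigr do rewrite mulrCA.
  rewrite -mulr_sumr -mulrBr normrM ger0_norm// -mulrA ler_wpM2l//.
  exact: pointmass_bonferroni.
pose cA M := \sum_(0 <= m < M) a m * (kappa * lam ^+ (j + m)).
have cvA M : A M n @[n --> \oo] --> cA M.
  rewrite /A /cA; elim: M => [|M IH].
    by under eq_fun do rewrite big_geq//; rewrite big_geq//; exact: cvg_cst.
  under eq_fun do rewrite big_nat_recr//=; rewrite big_nat_recr//=.
  by apply: cvgD => //; apply: cvgn_cstM; exact: Hw.
pose cB M := kappa * lam ^+ (j + M) / (j`! * M`!)%:R.
have cvB M : B M n @[n --> \oo] --> cB M by apply: cvgn_Mcst; exact: Hw.
have nz (m : nat) : (m`!)%:R != 0 :> R by rewrite pnatr_eq0 -lt0n fact_gt0.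
(* As [M] grows, the limiting main terms sum the exponential series at [- lam], which supplies the
   factor [expR (- lam)] of the Poisson mass; the limiting error [cB M] is a multiple of a term of
   the series at [lam]. *)
have cvcA : cA M @[M --> \oo] --> kappa * poisson_pmf lam j.
  have -> : cA = fun M => kappa * (lam ^+ j / j`!%:R) * series (exp_coeff (- lam)) M.
    apply/funext => M; rewrite /cA /series/= mulr_sumr; apply: eq_bigr => m _.
    rewrite /a /exp_coeff/= exprD (exprNn lam) natrM.
    move: ((-1) ^+ m) (lam ^+ m) (lam ^+ j) => x y z; field; by rewrite !nz.
  have -> : kappa * poisson_pmf lam j = kappa * (lam ^+ j / j`!%:R) * expR (- lam).
    by rewrite /poisson_pmf lam0 !mulrA.
  by apply: cvgn_cstM; exact: is_cvg_series_exp_coeff.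
have cvcB : cB M @[M --> \oo] --> 0.
  have -> : cB = fun M => kappa * (lam ^+ j / j`!%:R) * exp_coeff lam M.
    apply/funext => M; rewrite /cB /exp_coeff/= exprD natrM.
    move: (lam ^+ M) (lam ^+ j) => y z; field; by rewrite !nz.
  rewrite -[0](mulr0 (kappa * (lam ^+ j / j`!%:R))).
  by apply: cvgn_cstM; exact: cvg_exp_coeff.
apply/cvgrPdist_le => e e0.
have e4 : 0 < e / 4 by rewrite divr_gt0.
(* The truncation [M] is fixed before [n]. The four quarters of [e] pay for [cA] against its limit,
   [A] against [cA], the size of [cB], and [B] against [cB]. *)
have [M [hA hB]] : exists M, `|kappa * poisson_pmf lam j - cA M| <= e / 4 /\ `|0 - cB M| <= e / 4.
  have [M _ HM] := filterI ((cvgrPdist_le _ _).1 cvcA _ e4) ((cvgrPdist_le _ _).1 cvcB _ e4).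
  by exists M; exact: (HM M (leqnn M)).
near=> n.
have h1 : `|cA M - A M n| <= e / 4 by near: n; exact: (cvgrPdist_le _ _).1 (cvA M) _ e4.
have h2 : `|cB M - B M n| <= e / 4 by near: n; exact: (cvgrPdist_le _ _).1 (cvB M) _ e4.
move: hA hB h1 h2 (AB M n); rewrite !ler_norml => /andP[? ?] /andP[? ?] /andP[? ?] /andP[? ?] /andP[? ?].
by apply/andP; split; lra.
Unshelve. all: by end_near. Qed.

(** Induction on [l]: the factor [g l] of the last coordinate is absorbed into the weight. That the
    new weight has the required factorial moments is the transfer property of the last coordinate,
    under the weight multiplied by the falling factorials of the others. *)
Lemma transfers_prod (l : nat) (lam : nat -> R) (g : nat -> nat -> R) (v : nat -> R)
  (S : nat -> finType) (X : forall n, S n -> nat -> nat) (w : forall n, S n -> R) (kappa : R) :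
  (forall a x, 0 <= g a x) ->
  (forall a, transfers (lam a) (g a) (v a)) ->
  (forall n s, 0 <= w n s) ->
  (forall m : nat -> nat, (fun n => \sum_(s : S n) w n s * \prod_(a < l) (X n s a ^_ m a)%:R) @ \oo -->
      kappa * \prod_(a < l) lam a ^+ m a) ->
  (fun n => \sum_(s : S n) w n s * \prod_(a < l) g a (X n s a)) @ \oo --> kappa * \prod_(a < l) v a.
Proof.
move=> g0 tg; elim: l w kappa => [|l IH] w kappa w0 Hw.
  have E (f : forall n, S n -> 'I_0 -> R) :
      (fun n => \sum_(s : S n) w n s * \prod_(a < 0) f n s a) = fun n => \sum_(s : S n) w n s.
    by apply/funext => n; apply: eq_bigr => s _; rewrite big_ord0 mulr1.
  by move: (Hw (fun=> 0%N)); rewrite E (E (fun n s a => g a (X n s a))) !big_ord0.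
have -> : (fun n => \sum_(s : S n) w n s * \prod_(a < l.+1) g a (X n s a)) =
    (fun n => \sum_(s : S n) (w n s * g l (X n s l)) * \prod_(a < l) g a (X n s a)).
  by apply/funext => n; apply: eq_bigr => s _; rewrite big_ord_recr/= mulrAC mulrA.
rewrite big_ord_recr/= [X in _ --> X](_ : _ = kappa * v l * \prod_(a < l) v a); last by rewrite mulrAC mulrA.
apply: IH => [n s|m]; first by rewrite mulr_ge0.
have -> : (fun n => \sum_(s : S n) (w n s * g l (X n s l)) * \prod_(a < l) (X n s a ^_ m a)%:R) =
    (fun n => \sum_(s : S n) (w n s * \prod_(a < l) (X n s a ^_ m a)%:R) * g l (X n s l)).
  by apply/funext => n; apply: eq_bigr => s _; rewrite mulrAC.
rewrite mulrAC; apply: (tg l S (fun n s => X n s l)) => [n s|k].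
  by rewrite mulr_ge0// prodr_ge0.
(* The hypothesis on joint moments is used with exponent [k] at coordinate [l] and the old exponents
   below [l]. *)
pose m' := fun a => if a == l then k else m a.
have El : m' l = k by rewrite /m' eqxx.
have E (a : 'I_l) : m' a = m a by rewrite /m' ltn_eqF.
have := Hw m'; rewrite big_ord_recr/= El mulrA.
under [X in _ * X * _]eq_bigr do rewrite E.
suff -> : (fun n => \sum_(s : S n) w n s * \prod_(a < l.+1) (X n s a ^_ m' a)%:R) =
    (fun n => \sum_(s : S n) w n s * \prod_(a < l) (X n s a ^_ m a)%:R * (X n s l ^_ k)%:R) by [].
apply/funext => n; apply: eq_bigr => s _; rewrite big_ord_recr/= El mulrA.
by under eq_bigr do rewrite E.
Qed.
End Transfer.

(** * Riemann sums of iterated integrals *)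

Section UnitInterval.
Context {R : realType}.
Local Notation mu := (@lebesgue_measure R).

Definition unif_cont01 (h : R -> R) : Prop :=
  forall e, 0 < e -> exists2 d, 0 < d & forall x y : R, x \in `[0, 1] -> y \in `[0, 1] ->
    `|x - y| <= d -> `|h x - h y| <= e.

Lemma unif_cont01_integrable (h : R -> R) (a b : R) : 0 <= a -> b <= 1 -> unif_cont01 h ->
  mu.-integrable `[a, b] (EFin \o h).
Proof.
move=> a0 b1 uh; apply: continuous_compact_integrable; first exact: segment_compact.
have sub (x : R) : x \in `[a, b] -> x \in `[0, 1].
  by rewrite !in_itv/= => /andP[ax xb]; rewrite (le_trans a0 ax) (le_trans xb b1).
apply/subspace_continuousP => x /= xab; apply/cvgrPdist_le => /= e e0.
have [d d0 H] := uh e e0.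
rewrite near_withinE; apply/nbhs_ballP; exists d => //= y xy yab.
by apply: H; [exact: sub|exact: sub|exact: ltW].
Qed.

Lemma Rintegral_itv_approx (h : R -> R) (a b c e : R) : 0 <= a -> a <= b -> b <= 1 ->
  unif_cont01 h -> (forall x, x \in `[a, b] -> `|h x - c| <= e) ->
  `| Rintegral mu `[a, b] h - c * (b - a)| <= e * (b - a).
Proof.
move=> a0 ab b1 uh H.
have ih : mu.-integrable `[a, b] (EFin \o h) by exact: unif_cont01_integrable.
have icst (k : R) : mu.-integrable `[a, b] (EFin \o cst k).
  apply: unif_cont01_integrable => // e' e'0; exists 1 => // x y _ _ _.
  by rewrite /cst subrr normr0 ltW.
have Icst (k : R) : Rintegral mu `[a, b] (cst k) = k * (b - a).
  rewrite /cst Rintegral_cst//= lebesgue_measure_itv/= lte_fin.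
  case: ltP => [_|ba]/=; first by [].
  by rewrite (_ : a = b) ?subrr//; apply/eqP; rewrite eq_le ab ba.
have le_cst (f g : R -> R) : mu.-integrable `[a, b] (EFin \o f) -> mu.-integrable `[a, b] (EFin \o g) ->
    (forall x, x \in `[a, b] -> f x <= g x) -> Rintegral mu `[a, b] f <= Rintegral mu `[a, b] g.
  by move=> If Ig fg; exact: (@le_Rintegral _ _ _ mu).
rewrite ler_distl -mulrBl -mulrDl -!Icst; apply/andP; split; apply: le_cst => // x xab;
  by move: (H x xab); rewrite ler_distl => /andP[].
Qed.

Lemma int01_dist (f g : R -> R) (e : R) : unif_cont01 f -> unif_cont01 g ->
  (forall x, x \in `[0, 1] -> `|f x - g x| <= e) -> `|int01 f - int01 g| <= e.
Proof.
move=> uf ug H; rewrite /int01 -RintegralB//; [|exact: unif_cont01_integrable..].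
have ufg : unif_cont01 (fun x => f x - g x).
  move=> d d0; have d2 : 0 < d / 2 by rewrite divr_gt0.
  have [d1 d10 H1] := uf _ d2; have [d3 d30 H3] := ug _ d2.
  exists (Num.min d1 d3); first by rewrite lt_min d10 d30.
  move=> x y x01 y01; rewrite le_min => /andP[xy1 xy3].
  move: (H1 x y x01 y01 xy1) (H3 x y x01 y01 xy3); rewrite !ler_norml.
  by move=> /andP[? ?] /andP[? ?]; apply/andP; split; lra.
have := @Rintegral_itv_approx (fun x => f x - g x) 0 1 0 e (lexx _) ler01 (lexx _) ufg.
by rewrite !subr0 mul0r mulr1 subr0; apply => x x01; rewrite subr0; exact: H.
Qed.

(** Right endpoints are used, to match the points [p_a / n] of the hypothesis. Each of the cells of
    length [1 / N] contributes an error of at most [e / N]; the induction accumulates them from the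
    left. *)
Lemma int01_riemann (h : R -> R) (n : nat) (e : R) : unif_cont01 h ->
  (forall x y, x \in `[0, 1] -> y \in `[0, 1] -> `|x - y| <= n.+1%:R^-1 -> `|h x - h y| <= e) ->
  `|int01 h - n.+1%:R^-1 * \sum_(k < n.+1) h (k.+1%:R / n.+1%:R)| <= e.
Proof.
move=> uh H; set N : R := n.+1%:R.
have N0 : 0 < N by rewrite ltr0n.
suff S (k : nat) : (k <= n.+1)%N ->
  `|Rintegral mu `[0, k%:R / N] h - N^-1 * \sum_(i < k) h (i.+1%:R / N)| <= e * (k%:R / N).
  by have := S n.+1 (leqnn _); rewrite divff ?gt_eqF// mulr1.
elim: k => [_|k IH kn].
  by rewrite big_ord0 mul0r mulr0 subr0 set_itv1 Rintegral_set1 normr0 mulr0.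
have Ni : 0 < N^-1 by rewrite invr_gt0.
have k0 : 0 <= k%:R / N by rewrite divr_ge0// ltW.
have kk1 : k%:R / N <= k.+1%:R / N by rewrite ler_pM2r ?invr_gt0// ler_nat.
have k1 : k.+1%:R / N <= 1 by rewrite ler_pdivrMr// mul1r ler_nat.
have d : k.+1%:R / N - k%:R / N = N^-1 by rewrite -mulrBl -natrB// subSnn mul1r.
have ih (a b : R) : 0 <= a -> b <= 1 -> mu.-integrable `[a, b] (EFin \o h).
  by move=> a0 b1; exact: unif_cont01_integrable.
have := @Rintegral_itvB _ h (BLeft 0) (BRight (k.+1%:R / N)) (k%:R / N).
rewrite !bnd_simp => /(_ (ih _ _ (lexx _) k1) k0 kk1).
rewrite Rintegral_itv_obnd_cbnd; last first.
  apply: integrableS (ih _ _ k0 k1) => //.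
  by apply: subset_itvr; rewrite bnd_simp.
move=> /eqP; rewrite subr_eq => /eqP ->.
have sub (x : R) : x \in `[k%:R / N, k.+1%:R / N] -> x \in `[0, 1].
  by rewrite !in_itv/= => /andP[ax xb]; rewrite (le_trans k0 ax) (le_trans xb k1).
have := @Rintegral_itv_approx h (k%:R / N) (k.+1%:R / N) (h (k.+1%:R / N)) e k0 kk1 k1 uh.
have -> : e * (k.+1%:R / N) = e * N^-1 + e * (k%:R / N) by rewrite -natr1 mulrDl mul1r mulrDr addrC.
rewrite d big_ord_recr/= mulrDr [N^-1 * h _]mulrC => HH.
set A := Rintegral _ _ _; set B := Rintegral _ _ _ in IH *; set C := _ * \sum_(_ < _) _.
have {HH} : `|A - h (k.+1%:R / N) * N^-1| <= e * N^-1.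
  apply: HH => x xk; apply: H; [exact: sub|by apply: sub; rewrite in_itv/= kk1 lexx|].
  move: xk d Ni; rewrite in_itv/= -/N; move: (N^-1) (k%:R / N) (k.+1%:R / N) => p q r /andP[? ?] ? ?.
  by rewrite ler_norml; apply/andP; split; lra.
move: {IH}(IH (ltnW kn)); rewrite -/C -/B !ler_norml.
move: A B C (h _ / N) (e / N) (e * (k%:R / N)) => A B C p q r /andP[? ?] /andP[? ?].
by apply/andP; split; lra.
Qed.

Definition cube (u : nat -> R) : Prop := forall i, 0 <= u i <= 1.

Definition unif_cont (f : (nat -> R) -> R) : Prop :=
  forall e, 0 < e -> exists2 d, 0 < d & forall u v, cube u -> cube v ->
    (forall i, `|u i - v i| <= d) -> `|f u - f v| <= e.

Definition vcons (x : R) (v : nat -> R) : nat -> R := fun i => if i is i'.+1 then v i' else x.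

(** Follows the recursion of [iterint], with each integral replaced by its right-endpoint sum, so
    that the two can be compared one variable at a time. *)
Fixpoint riemann (n m : nat) (f : (nat -> R) -> R) : R :=
  if m is m'.+1 then
    n%:R^-1 * \sum_(k < n) riemann n m' (fun v => f (vcons (k.+1%:R / n%:R) v))
  else f (fun=> 0).

Lemma cube_vcons x v : x \in `[0, 1] -> cube v -> cube (vcons x v).
Proof. by rewrite in_itv/= => x01 cv [|i] /=. Qed.

Lemma unif_cont_vcons f x : x \in `[0, 1] -> unif_cont f -> unif_cont (fun v => f (vcons x v)).
Proof.
move=> x01 uf e e0; have [d d0 H] := uf e e0; exists d => // u v cu cv uv.
apply: H; [exact: cube_vcons|exact: cube_vcons|].
by move=> [|i] /=; [rewrite subrr normr0 ltW|exact: uv].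
Qed.

(** Stated for a single [m] because the induction needs it midway: continuity in the outermost
    variable at [m.+1] rests on the contraction estimate for the [m] inner ones. *)
Let iterint_contracts m := forall f g e, unif_cont f -> unif_cont g ->
  (forall u, cube u -> `|f u - g u| <= e) -> `|iterint m f - iterint m g| <= e.

Let unif_cont01_of_contracts m : iterint_contracts m ->
  forall f, unif_cont f -> unif_cont01 (fun x => iterint m (fun v => f (vcons x v))).
Proof.
move=> IH f uf e e0; have [d d0 H] := uf e e0; exists d => // x y x01 y01 xy.
apply: IH; [exact: unif_cont_vcons|exact: unif_cont_vcons|move=> u cu].
apply: H; [exact: cube_vcons|exact: cube_vcons|].
by move=> [|i] //=; rewrite subrr normr0 ltW.
Qed.

Lemma iterint_dist (m : nat) (f g : (nat -> R) -> R) (e : R) : unif_cont f -> unif_cont g ->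
  (forall u, cube u -> `|f u - g u| <= e) -> `|iterint m f - iterint m g| <= e.
Proof.
elim: m f g e => [|m IH] f g e uf ug H /=; first by apply: H => i; rewrite lexx ler01.
apply: int01_dist; [exact: unif_cont01_of_contracts|exact: unif_cont01_of_contracts|].
move=> x x01; apply: IH; [exact: unif_cont_vcons|exact: unif_cont_vcons|].
by move=> u cu; apply: H; exact: cube_vcons.
Qed.

(** Each variable costs one [e]: first the outer integral is discretised, then the inner ones at
    every grid point, where averaging does not increase the error. *)
Lemma iterint_riemann (n m : nat) (f : (nat -> R) -> R) (e : R) : unif_cont f ->
  (forall u v, cube u -> cube v -> (forall i, `|u i - v i| <= n.+1%:R^-1) -> `|f u - f v| <= e) ->
  `|iterint m f - riemann n.+1 m f| <= m%:R * e.
Proof.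
elim: m f => [|m IH] f uf H; first by rewrite /= subrr normr0 mul0r.
have Ni : 0 < n.+1%:R^-1 :> R by rewrite invr_gt0 ltr0n.
pose h x := iterint m (fun v => f (vcons x v)).
have h1 : `|int01 h - n.+1%:R^-1 * \sum_(k < n.+1) h (k.+1%:R / n.+1%:R)| <= e.
  apply: int01_riemann => [|x y x01 y01 xy].
    by apply: unif_cont01_of_contracts => // f' g' e'; exact: iterint_dist.
  apply: iterint_dist; [exact: unif_cont_vcons|exact: unif_cont_vcons|move=> u cu].
  apply: H; [exact: cube_vcons|exact: cube_vcons|].
  by move=> [|i] //=; rewrite subrr normr0 ltW.
rewrite -(subrK (n.+1%:R^-1 * \sum_(k < n.+1) h (k.+1%:R / n.+1%:R)) (iterint m.+1 f)) -addrA.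
rewrite (le_trans (ler_normD _ _))// -[m.+1%:R]natr1 mulrDl mul1r [leRHS]addrC lerD//=.
rewrite -mulrBr -sumrB normrM gtr0_norm// ler_pdivrMl ?ltr0n//.
rewrite (le_trans (ler_norm_sum _ _ _))//.
rewrite (_ : n.+1%:R * _ = \sum_(k < n.+1) m%:R * e); last first.
  by rewrite sumr_const card_ord mulr_natl.
apply: ler_sum => k _.
have k01 : k.+1%:R / n.+1%:R \in `[0 : R, 1].
  by rewrite in_itv/= divr_ge0//= ler_pdivrMr ?ltr0n// mul1r ler_nat.
apply: IH; first exact: unif_cont_vcons.
move=> u v cu cv uv; apply: H; [exact: cube_vcons|exact: cube_vcons|].
by move=> [|i] //=; rewrite subrr normr0 ltW.
Qed.

Lemma cvg_riemann (m : nat) (f : (nat -> R) -> R) : unif_cont f ->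
  riemann n.+1 m f @[n --> \oo] --> iterint m f.
Proof.
move=> uf; apply/cvgrPdist_le => /= e e0.
(* The total error is [m] times this; [m.+1] rather than [m] also covers [m = 0]. *)
have em : 0 < e / m.+1%:R by rewrite divr_gt0// ltr0n.
have [d d0 H] := uf _ em; near=> n.
have nd : n.+1%:R^-1 <= d.
  by apply: ltW; near: n; exact: (near_infty_natSinv_lt (PosNum d0)).
apply: le_trans (@iterint_riemann n m f (e / m.+1%:R) uf _) _.
  by move=> u v cu cv uv; apply: H => // i; exact: le_trans (uv i) nd.
by rewrite mulrCA -[leRHS]mulr1 ler_pM2l// ler_pdivrMr ?ltr0n// mul1r ler_nat.
Unshelve. all: by end_near. Qed.
End UnitInterval.

(** * Counting embedded unions of cycles *)

Section Glue.
Context {A B T : finType}.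

Definition glue (qp : {ffun A -> T} * {ffun B -> T}) : {ffun A + B -> T} :=
  [ffun t => match t with inl i => qp.1 i | inr j => qp.2 j end].

Lemma glue_bij : bijective glue.
Proof.
exists (fun p : {ffun A + B -> T} => ([ffun i => p (inl i)], [ffun j => p (inr j)])).
  by move=> [q p]; congr pair; apply/ffunP => i; rewrite !ffunE.
by move=> p; apply/ffunP => -[i|j]; rewrite ffunE/= ffunE.
Qed.

Lemma glue_injective (q : {ffun A -> T}) (p : {ffun B -> T}) :
  reflect [/\ injective q, injective p & forall i j, q i != p j] (injectiveb (glue (q, p))).
Proof.
apply: (iffP (injectiveP _)) => [inj|[injq injp qp]].
  split=> [i j e|i j e|i j].
  - by have := inj (inl i) (inl j); rewrite !ffunE/= => /(_ e) [].
  - by have := inj (inr i) (inr j); rewrite !ffunE/= => /(_ e) [].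
  - by apply/eqP => e; have := inj (inl i) (inr j); rewrite !ffunE/= => /(_ e).
move=> [i|i] [j|j]; rewrite !ffunE/=.
- by move/injq ->.
- by move=> e; move: (qp i j); rewrite e eqxx.
- by move=> e; move: (qp j i); rewrite e eqxx.
- by move/injp ->.
Qed.
End Glue.

(** A list [r] of lengths stands for the disjoint union [idx r] of cycles of these lengths,
    [step] being the cyclic shift. *)
Fixpoint idx (r : seq nat) : finType :=
  if r is a :: r' then ('I_a + idx r')%type : finType else void.

Fixpoint step (r : seq nat) : idx r -> idx r :=
  match r return idx r -> idx r with
  | [::] => id
  | a :: r' => fun t : 'I_a + idx r' => match t with inl i => inl (ordS i) | inr j => inr (step j) end
  end.

Fixpoint cycle_len (r : seq nat) : idx r -> nat :=
  match r return idx r -> nat with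
  | [::] => fun=> 0%N
  | a :: r' => fun t : 'I_a + idx r' => match t with inl i => a | inr j => cycle_len j end
  end.

Lemma step_inj (r : seq nat) : injective (@step r).
Proof.
elim: r => [|a r IH]; first by case.
move=> [i|i] [j|j] //= e.
  by rewrite (ordS_inj (inl_inj e)).
by rewrite (IH _ _ (inr_inj e)).
Qed.

Lemma card_cycle_len (r : seq nat) (a : nat) :
  #|[set t : idx r | cycle_len t == a]%SET| = (a * count_mem a r)%N.
Proof.
rewrite -sum1dep_card; elim: r => [|b r IH]; first by rewrite big_pred0 ?muln0// => -[].
rewrite big_sumType/= IH mulnDr; congr addn.
by case: eqP => [->|_]; rewrite ?big_pred0_eq ?muln0// sum1_card card_ord muln1.
Qed.

Lemma card_idx (r : seq nat) : #|idx r| = sumn r.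
Proof.
by elim: r => [|a r IH]; rewrite ?card_void//= card_sum card_ord IH.
Qed.

(** A map out of a disjoint union is a tuple of maps out of its parts, and the weight does not link
    different cycles. This factors the Riemann sum over [idx r] into one sum per cycle. *)
Lemma sum_prod_idx (R : comPzRingType) (T : finType) (w : T -> T -> R) (r : seq nat) :
  \sum_(p : {ffun idx r -> T}) \prod_t w (p t) (p (step t)) =
  \prod_(a <- r) \sum_(q : {ffun 'I_a -> T}) \prod_i w (q i) (q (ordS i)).
Proof.
elim: r => [|a r IH].
  rewrite big_nil (eq_bigr (fun=> 1)) => [|p _]; last by rewrite big_pred0// => -[].
  by rewrite sumr_const card_ffun card_void expn0.
rewrite big_cons -IH (reindex _ (onW_bij _ glue_bij))/= big_distrlr/= pair_bigA/=.
apply: eq_bigr => -[q p] _ /=; rewrite big_sumType/=.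
by congr (_ * _); apply: eq_bigr => i _; rewrite !ffunE.
Qed.

(** * Embeddings of a union of cycles into a permutation *)

Section Embeddings.
Context {T : finType} (s : {perm T}).
Implicit Types (a : nat) (r : seq nat).

Definition cyclic_map a (q : {ffun 'I_a -> T}) := injectiveb q && [forall i, s (q i) == q (ordS i)].

Definition embeds r : {set {ffun idx r -> T}} :=
  [set p : {ffun idx r -> T} | injectiveb p && [forall t, s (p t) == p (step t)]]%SET.

(** A cyclic map is determined by its value at 0, whose orbit then has exactly [a.+1] points. *)
Lemma cyclic_mapE a (q : {ffun 'I_a.+1 -> T}) : cyclic_map q ->
  (forall i, q i = (s ^+ i)%g (q ord0)) /\ #|porbit s (q ord0)| = a.+1.
Proof.
move=> /andP[/injectiveP injq /forallP cq].
have qE (k : nat) (ka : (k < a.+1)%N) : q (Ordinal ka) = iter k s (q ord0).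
  elim: k ka => [|k IH] ka; first by congr (q _); apply: val_inj.
  rewrite iterS -(IH (ltnW ka)) (eqP (cq _)); congr (q _); apply: val_inj.
  by rewrite /= modn_small.
have qi i : q i = iter i s (q ord0) by rewrite -(qE i (ltn_ord i)); congr (q _); apply: val_inj.
split=> [i|]; first by rewrite permX -qi.
have sa : iter a.+1 s (q ord0) = q ord0.
  rewrite iterS -(qE a (ltnSn a)) (eqP (cq _)); congr (q _); apply: val_inj => /=.
  exact: modnn.
have sk := iter_porbit s (q ord0).
have Ut := uniq_traject_porbit s (q ord0).
have k0 : (0 < #|porbit s (q ord0)|)%N by rewrite lt0n card_porbit_neq0.
set k := #|_| in sk Ut k0 *.
(* A longer orbit would contradict the return after [a.+1] steps, a shorter one the injectivity of
   [q]. *)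
apply/eqP; rewrite eqn_leq leqNgt [X in _ && X]leqNgt; apply/andP; split; apply/negP => lt.
  have := nth_uniq (q ord0) _ _ Ut; rewrite size_traject => /(_ a.+1 0%N lt k0).
  by rewrite !nth_traject//= -iterS sa eqxx.
have := qE k lt; rewrite sk => /injq /(congr1 val) /= k_0.
by rewrite k_0 in k0.
Qed.

(** Converse of [cyclic_mapE]: together they parametrise cyclic maps of length [a.+1] by the points
    on cycles of that length. *)
Lemma cyclic_map_orbit a (x : T) : #|porbit s x| = a.+1 ->
  cyclic_map [ffun i : 'I_a.+1 => (s ^+ i)%g x].
Proof.
move=> xa; have Ut := uniq_traject_porbit s x; rewrite xa in Ut.
apply/andP; split.
  apply/injectiveP => i j; rewrite !ffunE !permX => e; apply: val_inj; apply/eqP => /=.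
  rewrite -(nth_uniq x _ _ Ut) ?size_traject//.
  by rewrite !nth_traject// e.
apply/forallP => i; rewrite !ffunE !permX -iterS /=.
have [ia|] := ltnP i.+1 a.+1; first by rewrite modn_small.
rewrite ltnS => ai; have -> : i = a :> nat by apply/eqP; rewrite eqn_leq ai -ltnS ltn_ord.
by rewrite modnn -[X in _ == X](iter_porbit s x) xa.
Qed.

Lemma embeds_glue a r (q : {ffun 'I_a -> T}) (p : {ffun idx r -> T}) :
  (glue (q, p) \in embeds (a :: r)) =
  [&& p \in embeds r, cyclic_map q & [forall i, forall j, q i != p j]].
Proof.
rewrite !inE; apply/idP/idP.
  move=> /andP[/glue_injective[injq injp qp] /forallP H].
  apply/and3P; split.
  - apply/andP; split; first exact/injectiveP.
    by apply/forallP => j; move: (H (inr j)); rewrite !ffunE.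
  - apply/andP; split; first exact/injectiveP.
    by apply/forallP => i; move: (H (inl i)); rewrite !ffunE.
  - by apply/forallP => i; apply/forallP.
move=> /and3P[/andP[/injectiveP injp /forallP Hp] /andP[/injectiveP injq /forallP Hq] /forallP qp].
apply/andP; split.
  by apply/glue_injective; split=> // i; apply/forallP.
by apply/forallP => -[i|j]; rewrite !ffunE/=.
Qed.

Lemma card_porbit_embeds r (p : {ffun idx r -> T}) t :
  p \in embeds r -> #|porbit s (p t)| = cycle_len t.
Proof.
elim: r p t => [|a r IH] p; first by case.
have [g gK Kg] := @glue_bij 'I_a (idx r) T.
rewrite -[p]Kg; case: (g p) => q p' [i|j]; rewrite embeds_glue ffunE/= => /and3P[p'r cq _].
  case: a q i cq {g gK Kg IH p} => [|a] q i cq; first by case: i.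
  by have [qE qa] := cyclic_mapE cq; rewrite qE porbit_perm qa.
exact: IH.
Qed.

Lemma card_in_cycles a :
  #|[set x | #|porbit s x| == a]%SET| = (a * #|[set c in porbits s | #|c| == a]|)%N.
Proof.
rewrite -sum1dep_card (partition_big (porbit s) (mem [set c in porbits s | #|c| == a]%SET))/=; last first.
  by move=> x xa; rewrite inE xa imset_f.
rewrite mulnC -sum_nat_const; apply: eq_bigr => c.
rewrite inE => /andP[/imsetP[y _ ->] /eqP ya].
rewrite -[RHS]ya -sum1_card; apply: eq_bigl => x.
rewrite eq_porbit_mem; case: (boolP (x \in _)) => [|_]; last by rewrite andbF.
by rewrite -eq_porbit_mem => /eqP ->; rewrite ya eqxx.
Qed.

(** The image of [p] is stable under [s], so the new cycle only has to start outside of it;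
    it contains [count_mem a.+1 r] cycles of length [a.+1]. *)
Lemma card_cyclic_ext a r (p : {ffun idx r -> T}) : p \in embeds r ->
  #|[set q : {ffun 'I_a.+1 -> T} | cyclic_map q && [forall i, forall j, q i != p j]]%SET| =
  (a.+1 * (#|[set c in porbits s | #|c| == a.+1]%SET| - count_mem a.+1 r))%N.
Proof.
move=> pr; have injp : injective p by move: pr; rewrite inE => /andP[/injectiveP].
have comp t : s (p t) = p (step t) by move: pr; rewrite inE => /andP[_ /forallP /(_ t) /eqP].
have iterp k t : iter k s (p t) = p (iter k (@step r) t) by elim: k => // k IH; rewrite !iterS IH comp.
pose f (x : T) := [ffun i : 'I_a.+1 => (s ^+ i)%g x].
have fK : injective f.
  by move=> x y /ffunP /(_ ord0); rewrite !ffunE !perm1.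
pose X := [set x | #|porbit s x| == a.+1]%SET.
pose Y := (p @: [set t : idx r | cycle_len t == a.+1])%SET.
have -> : [set q : {ffun 'I_a.+1 -> T} | cyclic_map q && [forall i, forall j, q i != p j]]%SET =
          (f @: (X :\: Y))%SET.
  apply/setP => q; rewrite inE; apply/andP/imsetP.
    move=> [cq /forallP qp]; have [qE qo] := cyclic_mapE cq.
    exists (q ord0); last by apply/ffunP => i; rewrite ffunE qE.
    rewrite !inE qo eqxx andbT; apply/negP => /imsetP[t _ qt].
    by move: (qp ord0) => /forallP /(_ t); rewrite qt eqxx.
  move=> [x]; rewrite !inE => /andP[xY /eqP xa] ->; split; first exact: cyclic_map_orbit.
  apply/forallP => i; apply/forallP => j; rewrite ffunE permX; apply/negP => /eqP e.
  (* If the orbit of [x] meets the image of [p] after [i] steps, then [a.+1 - i] further steps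
     return to [x] without leaving that image. *)
  have xE : x = p (iter (a.+1 - i) (@step r) j).
    by rewrite -iterp -e -iterD subnK ?(ltnW (ltn_ord i))// -[in LHS](iter_porbit s x) xa.
  move/negP: xY; apply; apply/imsetP; exists (iter (a.+1 - i) (@step r) j) => //.
  by rewrite inE -(card_porbit_embeds _ pr) -xE xa.
rewrite card_imset// cardsD (finset.setIidPr _); last first.
  apply/fintype.subsetP => y /imsetP[t]; rewrite inE => /eqP ta ->.
  by rewrite inE (card_porbit_embeds _ pr) ta.
by rewrite card_imset// card_cycle_len card_in_cycles mulnBr.
Qed.

(** Cycles are placed from the tail of the list to its head: [a] starting points on each cycle of
    length [a] not yet occupied. Truncated subtraction gives 0 once no such cycle is left. *)
Fixpoint embeds_count r : nat :=
  if r is a :: r' then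
    (a * (#|[set c in porbits s | #|c| == a]%SET| - count_mem a r') * embeds_count r')%N
  else 1%N.

(** The tail is embedded first; by [card_cyclic_ext] the number of ways to add the head cycle is the
    same for every embedding of the tail. *)
Lemma card_embeds r : all (leq 1) r -> #|embeds r| = embeds_count r.
Proof.
elim: r => [_|[//|a] r IH /=].
  rewrite (_ : embeds [::] = [set: _]%SET) ?cardsT ?card_ffun ?card_void//.
  apply/setP => p; rewrite !inE; apply/andP; split; last by apply/forallP => -[].
  by apply/injectiveP => -[].
move=> /IH <-; transitivity (\sum_(p in embeds (a.+1 :: r)) 1)%N; first by rewrite sum1_card.
pose gl : {ffun 'I_a.+1 -> T} * {ffun idx r -> T} -> {ffun idx (a.+1 :: r) -> T} := glue.
have gb : bijective gl by exact: glue_bij.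
rewrite (reindex gl)/=; last exact: onW_bij.
rewrite (eq_bigl (fun x : {ffun 'I_a.+1 -> T} * {ffun idx r -> T} => (x.2 \in embeds r) &&
    (cyclic_map x.1 && [forall i, forall j, x.1 i != x.2 j]))); last first.
  by move=> [q p]; rewrite embeds_glue.
rewrite (reindex (fun x : {ffun idx r -> T} * {ffun 'I_a.+1 -> T} => (x.2, x.1))); last first.
  by exists (fun x => (x.2, x.1)) => -[].
rewrite -(pair_big_dep (mem (embeds r)) (fun p (q : {ffun 'I_a.+1 -> T}) =>
   cyclic_map q && [forall i, forall j, q i != p j]) (fun _ _ => 1%N))/=.
rewrite (eq_bigr (fun=> (a.+1 * (#|[set c in porbits s | #|c| == a.+1]%SET| - count_mem a.+1 r))%N)).
  by rewrite sum_nat_const mulnC.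
by move=> p pr; rewrite -(card_cyclic_ext a pr) -sum1dep_card.
Qed.

Lemma embeds_count_nseq a k r : a \notin r ->
  embeds_count (nseq k a ++ r) = (a ^ k * #|[set c in porbits s | #|c| == a]%SET| ^_ k * embeds_count r)%N.
Proof.
move=> ar; elim: k => [|k IH] /=; first by rewrite ffactn0 !mul1n.
rewrite IH ffactnSr count_cat count_nseq/= eqxx mul1n (count_memPn ar) addn0 expnS.
set C := #|_|; ring.
Qed.

(** Indices are shifted: [m a] counts the cycles of length [a.+1]. *)
Fixpoint lengths (m : nat -> nat) (l : nat) : seq nat :=
  if l is l'.+1 then nseq (m l') l'.+1 ++ lengths m l' else [::].

Lemma embeds_count_lengths m l :
  embeds_count (lengths m l) =
  (\prod_(a < l) (a.+1 ^ m a * #|[set c in porbits s | #|c| == a.+1]%SET| ^_ m a))%N.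
Proof.
elim: l => [|l IH]; first by rewrite big_ord0.
rewrite big_ord_recr/= mulnC -IH embeds_count_nseq//.
suff H k l' : (l' <= k)%N -> k.+1 \notin lengths m l' by exact: H.
elim: l' => //= l' IH' lk; rewrite mem_cat negb_or IH' ?(ltnW lk)// andbT.
by rewrite mem_nseq negb_and eqSS neq_ltn lk !orbT.
Qed.
End Embeddings.

(** * Riemann sums as sums over maps into the grid *)

Section RiemannSum.
Context {R : realType}.

Definition grid (n : nat) (k : 'I_n) : R := k.+1%:R / n%:R.

Lemma grid01 n (k : 'I_n) : grid k \in `[0, 1].
Proof.
have n0 : 0 < n%:R :> R by rewrite ltr0n (leq_ltn_trans _ (ltn_ord k)).
by rewrite in_itv/= divr_ge0//= ler_pdivrMr// mul1r ler_nat.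
Qed.

(** Padded with zeros, as [iterint] does with the coordinates from [m] on. *)
Definition grid_point (n m : nat) (p : {ffun 'I_m -> 'I_n}) : nat -> R :=
  fun i => if insub i is Some j then grid (p j) else 0.

Lemma grid_pointE n m (p : {ffun 'I_m -> 'I_n}) (j : 'I_m) : grid_point p j = grid (p j).
Proof. by rewrite /grid_point valK. Qed.

Lemma grid_point_ge n m (p : {ffun 'I_m -> 'I_n}) i : (m <= i)%N -> grid_point p i = 0.
Proof. by move=> mi; rewrite /grid_point insubN// -leqNgt. Qed.

Let ffun_cons (n m : nat) (xp : 'I_n * {ffun 'I_m -> 'I_n}) : {ffun 'I_m.+1 -> 'I_n} :=
  [ffun i => oapp xp.2 xp.1 (unlift ord0 i)].

Let ffun_cons_bij n m : bijective (@ffun_cons n m).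
Proof.
exists (fun p : {ffun 'I_m.+1 -> 'I_n} => (p ord0, [ffun j => p (lift ord0 j)])).
  move=> [x p]; congr pair; first by rewrite ffunE unlift_none.
  by apply/ffunP => j; rewrite !ffunE liftK.
by move=> p; apply/ffunP => i; rewrite ffunE; case: unliftP => [j|] -> /=; rewrite ?ffunE.
Qed.

Lemma riemannE (n m : nat) (f : (nat -> R) -> R) :
  riemann n m f = n%:R^-1 ^+ m * \sum_(p : {ffun 'I_m -> 'I_n}) f (grid_point p).
Proof.
elim: m f => [|m IH] f.
  rewrite expr0 mul1r/= (eq_bigr (fun=> f (fun=> 0))) => [|p _].
    by rewrite sumr_const card_ffun !card_ord expn0.
  by congr f; apply/funext => i; rewrite grid_point_ge.
rewrite /= exprS -mulrA; congr (_ * _).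
rewrite (reindex _ (onW_bij _ (@ffun_cons_bij n m)))/=.
rewrite -(pair_bigA _ (fun x p => f (grid_point (ffun_cons (x, p)))))/= mulr_sumr.
apply: eq_bigr => k _; rewrite IH; congr (_ * _); apply: eq_bigr => p _.
congr f; apply/funext => -[|i] /=.
  by rewrite -[RHS]/(grid_point _ (ord0 : 'I_m.+1)) grid_pointE ffunE unlift_none.
have [im|mi] := ltnP i m; last by rewrite !grid_point_ge.
have -> : i = Ordinal im :> nat by [].
rewrite -[RHS]/(grid_point _ (lift ord0 (Ordinal im))).
by rewrite !grid_pointE ffunE liftK.
Qed.

Lemma unif_contM (f g : (nat -> R) -> R) (A B : R) :
  unif_cont f -> unif_cont g ->
  (forall u, cube u -> `|f u| <= A) -> (forall u, cube u -> `|g u| <= B) ->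
  unif_cont (fun u => f u * g u).
Proof.
move=> uf ug fA gB e e0.
have c0 : cube (fun=> 0 : R) by move=> i; rewrite lexx ler01.
have A0 : 0 <= A := le_trans (normr_ge0 _) (fA _ c0).
have B0 : 0 <= B := le_trans (normr_ge0 _) (gB _ c0).
(* The added 1 keeps the denominator positive when both bounds are 0. *)
have AB : 0 < A + B + 1 by lra.
have e1 : 0 < e / (A + B + 1) by rewrite divr_gt0.
have [d1 d10 H1] := uf _ e1; have [d2 d20 H2] := ug _ e1.
exists (Num.min d1 d2); first by rewrite lt_min d10 d20.
move=> u v cu cv uv.
have -> : f u * g u - f v * g v = f u * (g u - g v) + (f u - f v) * g v by ring.
rewrite (le_trans (ler_normD _ _))// !normrM.
have h1 : `|f u - f v| <= e / (A + B + 1).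
  by apply: H1 => // i; apply: le_trans (uv i) _; rewrite ge_min lexx.
have h2 : `|g u - g v| <= e / (A + B + 1).
  by apply: H2 => // i; apply: le_trans (uv i) _; rewrite ge_min lexx orbT.
apply: (@le_trans _ _ (A * (e / (A + B + 1)) + e / (A + B + 1) * B)).
  by rewrite lerD// ler_pM// ?fA ?gB.
rewrite mulrC -mulrDr mulrAC ler_pdivrMr// ler_pM2l//; lra.
Qed.

Lemma unif_cont_prod (B : R) (F : nat -> (nat -> R) -> R) (n : nat) :
  (forall i, unif_cont (F i)) -> (forall i u, cube u -> `|F i u| <= B) ->
  unif_cont (fun u => \prod_(i < n) F i u).
Proof.
move=> uF FB; elim: n => [|n IH].
  move=> e e0; exists 1 => // u v _ _ _; rewrite !big_ord0 subrr normr0; exact: ltW.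
rewrite (_ : (fun u => _) = fun u => (\prod_(i < n) F i u) * F n u); last first.
  by apply/funext => u; rewrite big_ord_recr.
apply: (@unif_contM _ _ (B ^+ n) B) => // [u cu|u cu]; last exact: FB.
rewrite normr_prod -[X in B ^+ X](card_ord n) -prodr_const; apply: ler_prod => i _.
by rewrite normr_ge0 FB.
Qed.
End RiemannSum.

(** * The density and its integrals along cycles *)

Section Density.
Context {R : realType} (rho : R -> R -> R).
Hypothesis rhoC : classC rho.

Lemma density_bounds : exists b B : R, [/\ 0 < b, 0 < B &
  forall x y, x \in `[0, 1] -> y \in `[0, 1] -> b <= rho x y <= B].
Proof.
have [rho0 crho _ _] := rhoC.
set Q := (_ `*` _)%classic in crho.
have cQ : compact Q by apply: compact_setX; exact: segment_compact.
have Q0 : Q !=set0 by exists (0, 0); split; rewrite /= in_itv/= lexx ler01.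
have [[cx cy] + Hmin] := compact_EVT_min Q0 cQ crho.
rewrite inE => -[/= cx01 cy01].
have [[dx dy] + Hmax] := compact_EVT_max Q0 cQ crho.
rewrite inE => -[/= dx01 dy01].
exists (rho cx cy), (rho dx dy); split; [exact: rho0|exact: rho0|].
move=> x y x01 y01; have xyQ : (x, y) \in Q by rewrite inE.
by rewrite (Hmin _ xyQ) (Hmax _ xyQ).
Qed.

Lemma density_unif_cont (e : R) : 0 < e -> exists2 d, 0 < d & forall x y x' y',
  x \in `[0, 1] -> y \in `[0, 1] -> x' \in `[0, 1] -> y' \in `[0, 1] ->
  `|x - x'| <= d -> `|y - y'| <= d -> `|rho x y - rho x' y'| <= e.
Proof.
move=> e0; have [_ crho _ _] := rhoC.
set Q := (_ `*` _)%classic in crho.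
have cQ : compact Q by apply: compact_setX; exact: segment_compact.
have e2 : 0 < e / 2 by rewrite divr_gt0.
pose Pd (d : R) (p : R * R) := forall q : R * R, Q q -> `|p.1 - q.1| <= d -> `|p.2 - q.2| <= d ->
  Q p -> `|rho p.1 p.2 - rho q.1 q.2| <= e.
(* Heine's argument: near each point of the compact square a modulus valid for [e / 2] at that point
   gives half that modulus for [e] at its neighbours, and compactness makes it uniform. *)
have : \forall d \near 0^'+, Q `<=` Pd d.
  apply: ((compact_near_coveringP Q).1 cQ) => p Qp.
  have := (subspace_continuousP Q _).1 crho p Qp => /cvgrPdist_le/(_ _ e2) /=.
  rewrite near_withinE => /nbhs_ballP[r /= r0 Hr].
  have r2 : 0 < r / 2 by rewrite divr_gt0.
  exists (ball p (r / 2), [set d | d < r / 2]) => /=.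
    by split; [exact: nbhsx_ballx|exact: nbhs_right_lt].
  move=> [p' d] /= [[p1 p2] dr] q Qq q1 q2 Qp'.
  have h1 : `|rho p.1 p.2 - rho p'.1 p'.2| <= e / 2.
    apply: Hr => //; split; rewrite /ball/=.
      by apply: lt_le_trans p1 _; lra.
    by apply: lt_le_trans p2 _; lra.
  have h2 : `|rho p.1 p.2 - rho q.1 q.2| <= e / 2.
    apply: Hr => //; split; rewrite /ball/=.
      rewrite -(subrK p'.1 p.1) -addrA (le_lt_trans (ler_normD _ _))//.
      by move: p1; rewrite /ball/= => p1; lra.
    rewrite -(subrK p'.2 p.2) -addrA (le_lt_trans (ler_normD _ _))//.
    by move: p2; rewrite /ball/= => p2; lra.
  move: h1 h2; rewrite !ler_norml => /andP[? ?] /andP[? ?]; apply/andP; split; lra.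
move=> H; have [d [/= d0 Hd]] : exists d : R, 0 < d /\ Q `<=` Pd d.
  near (0 : R)^'+ => d; exists d; split; first by near: d; exact: nbhs_right_gt.
  by near: d.
exists d => // x y x' y' x01 y01 x'01 y'01 xx' yy'.
have Qp : Q (x, y) by [].
exact: (Hd _ Qp (x', y')).
Unshelve. all: by end_near. Qed.

Definition cycle_density (a : nat) (u : nat -> R) : R := \prod_(i < a) rho (u i) (u (i.+1 %% a)%N).

Lemma cycle_density_unif_cont (a : nat) : unif_cont (cycle_density a).
Proof.
have [b [B [b0 B0 bB]]] := density_bounds.
have cubeE u i : cube u -> (u i : R) \in `[0, 1] by move=> /(_ i); rewrite in_itv.
apply: (@unif_cont_prod _ B (fun i u => rho (u i) (u (i.+1 %% a)%N))) => [i e e0|i u cu].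
  have [d d0 H] := density_unif_cont e0; exists d => // u v cu cv uv.
  by apply: H; rewrite ?cubeE.
have /andP[h1 h2] := bB _ _ (cubeE u i cu) (cubeE u (i.+1 %% a)%N cu).
by rewrite ger0_norm// (le_trans _ h1)// ltW.
Qed.

(** The trace of the [a]-th power of the matrix with entries [rho (i/n) (j/n) / n]; walks with
    repeated vertices are included. *)
Definition closed_walk_sum (n a : nat) : R := n%:R^-1 ^+ a *
  \sum_(q : {ffun 'I_a -> 'I_n}) \prod_i rho (grid (q i)) (grid (q (ordS i))).

Lemma closed_walk_sumE n a : closed_walk_sum n a = riemann n a (cycle_density a).
Proof.
rewrite riemannE; congr (_ * _); apply: eq_bigr => q _; apply: eq_bigr => i _.
by rewrite grid_pointE -[(i.+1 %% a)%N]/(val (ordS i)) grid_pointE.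
Qed.

Lemma cvg_closed_walk_sum a : (0 < a)%N ->
  closed_walk_sum n.+1 a @[n --> \oo] --> a%:R * c_rho rho a.
Proof.
move=> a0; rewrite /c_rho mulVKf ?pnatr_eq0 -?lt0n//.
under eq_fun do rewrite closed_walk_sumE.
exact: cvg_riemann (cycle_density_unif_cont a).
Qed.

(** The lower bound [b] of the density gives [b ^+ a] below every closed walk sum, hence below their
    limit. Positivity selects the Poisson formula in [poisson_pmf]. *)
Lemma c_rho_gt0 a : (0 < a)%N -> 0 < c_rho rho a.
Proof.
move=> a0; have [b [B [b0 B0 bB]]] := density_bounds.
have := cvg_closed_walk_sum a0.
suff H n : b ^+ a <= closed_walk_sum n.+1 a.
  move=> cv; have : b ^+ a <= a%:R * c_rho rho a.
    by rewrite -(cvg_lim _ cv)//; apply: limr_ge; [apply/cvg_ex; eexists; exact: cv|exact: nearW].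
  by move=> /(lt_le_trans (exprn_gt0 a b0)); rewrite pmulr_rgt0// ltr0n.
rewrite /closed_walk_sum exprVn mulrC ler_pdivlMr ?exprn_gt0 ?ltr0n//.
have -> : b ^+ a * n.+1%:R ^+ a = \sum_(q : {ffun 'I_a -> 'I_n.+1}) \prod_(i < a) b.
  by rewrite sumr_const card_ffun !card_ord prodr_const card_ord -natrX mulr_natr.
apply: ler_sum => q _; apply: ler_prod => i _; rewrite (ltW b0)/=.
by have /andP[] := bB _ _ (grid01 (q i)) (grid01 (q (ordS i))).
Qed.
End Density.

(** * Convergence of the cycle counts *)

(** The proportion of injective maps among all maps from [L] points to [n.+1] points. *)
Lemma cvg_ffact_ratio (R : realType) (L : nat) :
  ((n.+1 ^_ L)%:R / n.+1%:R ^+ L : R) @[n --> \oo] --> (1 : R).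
Proof.
elim: L => [|L IH].
  by under eq_fun do rewrite ffactn0 expr0 divr1; exact: cvg_cst.
have -> : (fun n => (n.+1 ^_ L.+1)%:R / n.+1%:R ^+ L.+1 : R) =
    (fun n => (n.+1 ^_ L)%:R / n.+1%:R ^+ L * ((n.+1 - L)%:R / n.+1%:R)).
  by apply/funext => n; rewrite ffactnSr natrM exprSr invfM mulrACA.
suff H : (fun n => (n.+1 - L)%:R / n.+1%:R : R) @ \oo --> (1 : R).
  by have := cvgnM IH H; rewrite mulr1.
have : (fun n => 1 - L%:R * n.+1%:R^-1 : R) @ \oo --> (1 - L%:R * 0 : R).
  by apply: cvgB; [exact: cvg_cst|apply: cvgn_cstM; exact: cvg_harmonic].
rewrite mulr0 subr0; apply: cvg_trans; apply: near_eq_cvg; near=> n.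
have nL : (L <= n.+1)%N by apply: leqW; near: n; exact: nbhs_infty_ge.
by rewrite natrB// mulrBl divff// pnatr_eq0.
Unshelve. all: by end_near. Qed.

Section Permutations.
Context {R : realType} (rho : R -> R -> R) (P : forall n : nat, {perm 'I_n} -> R).
Hypothesis rhoC : classC rho.
Hypothesis P1 : forall n, (0 < n)%N -> \sum_(s : {perm 'I_n}) P s = 1.
Hypothesis Pdev : forall l : nat, (0 < l)%N -> (fun n => sup_dev rho l (@P n)) @ \oo --> 0.

Let dens n (i j : 'I_n) : R := rho (grid i) (grid j).

(** The hypothesis controls a relative error; multiplying by the density product, which is at most
    [B ^+ l], makes it absolute. *)
Lemma prob_map_approx n l (B : R) (p q : {ffun 'I_l -> 'I_n}) : 
  (forall x y, x \in `[0, 1] -> y \in `[0, 1] -> 0 < rho x y <= B) ->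
  injectiveb p -> injectiveb q ->
  `| n%:R ^+ l * prob_map (@P n) p q - \prod_(a < l) dens (p a) (q a) | <=
    B ^+ l * sup_dev rho l (@P n).
Proof.
move=> rB ip iq; set W := \prod_(a < l) _.
have W0 : 0 < W.
  by apply: prodr_gt0 => a _; have /andP[] := rB _ _ (grid01 (p a)) (grid01 (q a)).
have WB : W <= B ^+ l.
  rewrite -[X in B ^+ X](card_ord l) -prodr_const; apply: ler_prod => a _.
  by have /andP[/ltW -> ->] := rB _ _ (grid01 (p a)) (grid01 (q a)).
set X := _ * prob_map _ _ _.
have -> : X - W = W * (X / W - 1) by rewrite mulrBr mulr1 mulrC divfK// gt_eqF.
rewrite normrM (gtr0_norm W0); apply: ler_pM => //; first exact: ltW.
pose F (p q : {ffun 'I_l -> 'I_n}) : R := `|(n%:R ^+ l * prob_map (@P n) p q) /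
  (\prod_(a < l) rho ((p a).+1%:R / n%:R) ((q a).+1%:R / n%:R)) - 1|.
apply: (le_trans (le_bigmax_cond 0 (F p) iq)).
exact: (le_bigmax_cond 0 (fun p : {ffun 'I_l -> 'I_n} =>
  \big[Num.max/0]_(q : {ffun 'I_l -> 'I_n} | injectiveb q) F p q) ip).
Qed.

(** Transport along an enumeration of [T], with target tuple [p] composed with [tau]; injectivity of
    [tau] makes this target admissible. *)
Lemma prob_map_approx_fin n (T : finType) (B : R) (p : {ffun T -> 'I_n}) (tau : T -> T) : 
  (forall x y, x \in `[0, 1] -> y \in `[0, 1] -> 0 < rho x y <= B) ->
  injective tau -> injectiveb p ->
  `| n%:R ^+ #|T| * \sum_(s : {perm 'I_n} | [forall t, s (p t) == p (tau t)]) P s -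
      \prod_t dens (p t) (p (tau t)) | <= B ^+ #|T| * sup_dev rho #|T| (@P n).
Proof.
move=> rB itau /injectiveP ip.
pose p' := [ffun a : 'I_#|T| => p (enum_val a)].
pose q' := [ffun a : 'I_#|T| => p (tau (enum_val a))].
have ip' : injectiveb p'.
  by apply/injectiveP => a b; rewrite !ffunE => /ip /enum_val_inj.
have iq' : injectiveb q'.
  by apply/injectiveP => a b; rewrite !ffunE => /ip /itau /enum_val_inj.
have := prob_map_approx rB ip' iq'.
have -> : prob_map (@P n) p' q' = \sum_(s : {perm 'I_n} | [forall t, s (p t) == p (tau t)]) P s.
  apply: eq_bigl => s; apply/forallP/forallP => H t.
    by move: (H (enum_rank t)); rewrite !ffunE enum_rankK.
  by rewrite !ffunE.
suff -> : \prod_(a < #|T|) dens (p' a) (q' a) = \prod_t dens (p t) (p (tau t)) by [].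
rewrite [RHS](reindex (@enum_val T T))/=; last exact: (onW_bij _ (@enum_val_bij T)).
by apply: eq_bigr => a _; rewrite !ffunE.
Qed.

Lemma cvg_embeds_count (r : seq nat) : all (leq 1) r ->
  (\sum_(s : {perm 'I_n.+1}) P s * (embeds_count s r)%:R) @[n --> \oo] -->
  \prod_(a <- r) (a%:R * c_rho rho a).
Proof.
(* The empty list is treated apart, since the hypothesis concerns tuples of positive length. *)
move=> r1; have [->|rN] := eqVneq r [::].
  rewrite big_nil; under eq_fun do (under eq_bigr do rewrite mulr1; rewrite P1//).
  exact: cvg_cst.
pose L := #|idx r|.
have L0 : (0 < L)%N by rewrite /L card_idx; case: r r1 rN {L} => //= -[].
have [b [B [b0 B0 bB]]] := density_bounds rhoC.
have rB x y : x \in `[0, 1] -> y \in `[0, 1] -> 0 < rho x y <= B.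
  by move=> x01 y01; have /andP[h ->] := bB _ _ x01 y01; rewrite (lt_le_trans b0 h).
pose W n (p : {ffun idx r -> 'I_n}) : R := \prod_t dens (p t) (p (step t)).
pose S n : R := n%:R^-1 ^+ L * \sum_(p : {ffun idx r -> 'I_n}) W n p.
(* First the deviation of the probabilities over injective maps, then the contribution to [S] of the
   non-injective ones, a vanishing proportion with weights at most [B ^+ L]. *)
pose err n : R := B ^+ L * sup_dev rho L (@P n) + B ^+ L * (1 - (n ^_ L)%:R / n%:R ^+ L).
have W0 n p : 0 <= W n p <= B ^+ L.
  rewrite /W -prodr_const; apply/andP; split.
    by apply: prodr_ge0 => t _; have /andP[/ltW] := rB _ _ (grid01 (p t)) (grid01 (p (step t))).
  by apply: ler_prod => t _; have /andP[/ltW -> ->] := rB _ _ (grid01 (p t)) (grid01 (p (step t))).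
have cS : S n.+1 @[n --> \oo] --> \prod_(a <- r) (a%:R * c_rho rho a).
  have -> : (fun n => S n.+1) = (fun n => \prod_(a <- r) closed_walk_sum rho n.+1 a).
    apply/funext => n; rewrite /S /W sum_prod_idx /closed_walk_sum big_split/=; congr (_ * _).
    by rewrite prodrXr /L card_idx sumnE.
  elim: r r1 {rN L L0 W S err W0} => [_|a r IH /= /andP[a0 r1]].
    by under eq_fun do rewrite big_nil; rewrite big_nil; exact: cvg_cst.
  under eq_fun do rewrite big_cons; rewrite big_cons.
  by apply: cvgM; [exact: cvg_closed_walk_sum|exact: IH].
have cerr : err n.+1 @[n --> \oo] --> 0.
  suff : err n.+1 @[n --> \oo] --> B ^+ L * 0 + B ^+ L * (1 - 1).
    by rewrite subrr mulr0 addr0.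
  apply: cvgD; apply: cvgn_cstM.
    by have := Pdev L0; rewrite -(cvg_shiftS (fun n => sup_dev rho L (@P n))).
  by apply: cvgB; [exact: cvg_cst|exact: cvg_ffact_ratio].
suff H n : `|\sum_(s : {perm 'I_n.+1}) P s * (embeds_count s r)%:R - S n.+1| <= err n.+1.
  suff : (fun n => \sum_(s : {perm 'I_n.+1}) P s * (embeds_count s r)%:R) @ \oo -->
    \prod_(a <- r) (a%:R * c_rho rho a) + 0 by rewrite addr0.
  have -> : (fun n => \sum_(s : {perm 'I_n.+1}) P s * (embeds_count s r)%:R) =
     (fun n => S n.+1 + (\sum_(s : {perm 'I_n.+1}) P s * (embeds_count s r)%:R - S n.+1)).
    by apply/funext => n; rewrite addrC subrK.
  apply: cvgD => //; apply/norm_cvg0P; apply: (squeeze_cvgr _ (cvg_cst 0) cerr).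
  by apply: nearW => n; rewrite normr_ge0 H.
set N : R := n.+1%:R.
have N0 : 0 < N by rewrite ltr0n.
pose A (p : {ffun idx r -> 'I_n.+1}) := \sum_(s : {perm 'I_n.+1} | [forall t, s (p t) == p (step t)]) P s.
(* Exchange of summation: the expected number of embeddings is the sum, over injective [p], of the
   probability that the permutation acts on the image of [p] as [step]. *)
have -> : \sum_(s : {perm 'I_n.+1}) P s * (embeds_count s r)%:R =
    \sum_(p : {ffun idx r -> 'I_n.+1} | injectiveb p) A p.
  rewrite /A (exchange_big_dep predT)//=; apply: eq_bigr => s _.
  rewrite -card_embeds// -sum1_card natr_sum mulr_sumr.
  by apply: eq_big => [p|p _]; rewrite ?inE ?mulr1.
have card_inj : \sum_(p : {ffun idx r -> 'I_n.+1} | injectiveb p) 1 = (n.+1 ^_ L)%:R :> R.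
  by rewrite (eq_bigr (fun=> 1%:R))// -natr_sum sum1dep_card card_inj_ffuns card_ord.
have sum_inj v : \sum_(p : {ffun idx r -> 'I_n.+1} | injectiveb p) v = v * (n.+1 ^_ L)%:R :> R.
  by rewrite -card_inj mulr_sumr; apply: eq_bigr => p _; rewrite mulr1.
have card_all : \sum_(p : {ffun idx r -> 'I_n.+1}) 1 = N ^+ L :> R.
  by rewrite sumr_const card_ffun card_ord natrX.
have NL : 0 < N ^+ L by rewrite exprn_gt0.
have Ni : 0 <= (N ^+ L)^-1 by rewrite invr_ge0 ltW.
have -> : S n.+1 = N^-1 ^+ L * (\sum_(p : {ffun idx r -> 'I_n.+1} | injectiveb p) W n.+1 p) +
   N^-1 ^+ L * (\sum_(p : {ffun idx r -> 'I_n.+1} | ~~ injectiveb p) W n.+1 p).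
  by rewrite -mulrDr /S (bigID (fun p : {ffun idx r -> 'I_n.+1} => injectiveb p)).
rewrite opprD addrA (le_trans (ler_normB _ _))// lerD//.
  rewrite mulr_sumr -sumrB (le_trans (ler_norm_sum _ _ _))//.
  apply: (@le_trans _ _ (\sum_(p : {ffun idx r -> 'I_n.+1} | injectiveb p)
      N^-1 ^+ L * (B ^+ L * sup_dev rho L (@P n.+1)))).
    apply: ler_sum => p ip; rewrite exprVn.
    have -> : A p - (N ^+ L)^-1 * W n.+1 p = (N ^+ L)^-1 * (N ^+ L * A p - W n.+1 p).
      by rewrite mulrBr mulKf// expf_neq0// gt_eqF.
    rewrite normrM (ger0_norm Ni) ler_wpM2l//.
    exact: prob_map_approx_fin (@step_inj r) ip.
  have D0 : 0 <= B ^+ L * sup_dev rho L (@P n.+1).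
    rewrite mulr_ge0 ?exprn_ge0 ?(ltW B0)// /sup_dev.
    by apply: bigmax_ge_id.
  rewrite sum_inj exprVn mulrAC -[leRHS]mul1r.
  rewrite ler_wpM2r// mulrC ler_pdivrMr// mul1r -natrX ler_nat.
  by elim: (L) => // k IH; rewrite ffactnSr expnSr leq_mul// leq_subr.
rewrite ger0_norm; last first.
  by rewrite exprVn mulr_ge0// sumr_ge0// => p _; have /andP[] := W0 n.+1 p.
rewrite exprVn mulrC ler_pdivrMr//.
apply: (@le_trans _ _ (\sum_(p : {ffun idx r -> 'I_n.+1} | ~~ injectiveb p) B ^+ L * 1)).
  by apply: ler_sum => p _; rewrite mulr1; have /andP[] := W0 n.+1 p.
rewrite -mulr_sumr -mulrA ler_wpM2l ?exprn_ge0 ?(ltW B0)//.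
rewrite mulrBl mul1r divfK ?gt_eqF// -card_all -card_inj.
by rewrite [X in _ <= X - _](bigID (fun p : {ffun idx r -> 'I_n.+1} => injectiveb p))/= addrAC subrr add0r.
Qed.
End Permutations.

Section Main.
Context {R : realType} (rho : R -> R -> R) (P : forall n : nat, {perm 'I_n} -> R).
Hypothesis rhoC : classC rho.
Hypothesis P0 : forall n, (0 < n)%N -> forall s : {perm 'I_n}, 0 <= P s.
Hypothesis P1 : forall n, (0 < n)%N -> \sum_(s : {perm 'I_n}) P s = 1.
Hypothesis Pdev : forall l : nat, (0 < l)%N -> (fun n => sup_dev rho l (@P n)) @ \oo --> 0.

Lemma cvg_factorial_moments (l : nat) (m : nat -> nat) :
  (fun n => \sum_(s : {perm 'I_n.+1}) P s * \prod_(a < l) (ncycles s a.+1 ^_ m a)%:R) @ \oo -->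
  \prod_(a < l) c_rho rho a.+1 ^+ m a.
Proof.
(* The number of choices of starting points on the cycles, by which the embedding counts exceed the
   product of falling factorials. *)
pose K : R := \prod_(a < l) a.+1%:R ^+ m a.
have K0 : K != 0 by apply/prodf_neq0 => a _; rewrite expf_neq0// pnatr_eq0.
have r1 : all (leq 1) (lengths m l).
  by elim: l {K K0} => //= l IH; rewrite all_cat all_nseq orbT.
have := cvg_embeds_count rhoC P1 Pdev r1.
have -> : \prod_(a <- lengths m l) (a%:R * c_rho rho a) = K * \prod_(a < l) c_rho rho a.+1 ^+ m a.
  rewrite /K -big_split/=; elim: l {K K0 r1} => [|l IH]; first by rewrite big_nil big_ord0.
  rewrite big_ord_recr/= big_cat/= IH mulrC; congr (_ * _).
  by rewrite big_nseq iter_mulr_1 exprMn.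
move=> /(cvgn_cstM (c := K^-1)); rewrite mulKf//.
suff -> : (fun n => K^-1 * \sum_(s : {perm 'I_n.+1}) P s * (embeds_count s (lengths m l))%:R) =
  (fun n => \sum_(s : {perm 'I_n.+1}) P s * \prod_(a < l) (ncycles s a.+1 ^_ m a)%:R) by [].
apply/funext => n; rewrite mulr_sumr; apply: eq_bigr => s _.
rewrite embeds_count_lengths natr_prod; under eq_bigr do rewrite natrM natrX.
by rewrite big_split/= -/K mulrCA mulKf.
Qed.

Lemma cvg_cycle_statistic (l : nat) (g : nat -> nat -> R) (v : nat -> R) :
  (forall a x, 0 <= g a x) -> (forall a, transfers (c_rho rho a.+1) (g a) (v a)) ->
  (fun n => \sum_(s : {perm 'I_n}) P s * \prod_(a < l) g a (ncycles s a.+1)) @ \oo -->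
  \prod_(a < l) v a.
Proof.
(* The shift to [n.+1] discards [n = 0], where nothing is assumed of [P]. *)
move=> g0 tg; rewrite -(cvg_shiftS (fun n => \sum_(s : {perm 'I_n}) _)).
rewrite [in X in _ --> X](_ : \prod_(a < l) v a = 1 * \prod_(a < l) v a); last by rewrite mul1r.
apply: (transfers_prod (X := fun n (s : {perm 'I_n.+1}) a => ncycles s a.+1)
  (lam := fun a => c_rho rho a.+1)) => // [n s|m]; first exact: P0.
by rewrite mul1r; exact: cvg_factorial_moments.
Qed.
End Main.

Theorem theorem1p4 (R : realType) (rho : R -> R -> R)
  (P : forall n : nat, {perm 'I_n} -> R) :
  classC rho ->
  (forall n, (0 < n)%N -> forall s, 0 <= P n s) ->
  (forall n, (0 < n)%N -> \sum_(s : {perm 'I_n}) P n s = 1) ->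
  (forall l : nat, (0 < l)%N -> (fun n => sup_dev rho l (P n)) @ \oo --> 0) ->
  (forall (l : nat) (k : 'I_l -> nat),
     (fun n => \sum_(s : {perm 'I_n}) P n s *
                 \prod_(a < l) (ncycles s a.+1)%:R ^+ k a) @ \oo -->
     \prod_(a < l) poisson_moment (c_rho rho a.+1) (k a))
  /\
  (forall (l : nat) (j : 'I_l -> nat),
     (fun n => \sum_(s : {perm 'I_n} | [forall a : 'I_l, ncycles s a.+1 == j a]) P n s)
       @ \oo -->
     \prod_(a < l) poisson_pmf (c_rho rho a.+1) (j a)).
Proof.
move=> rhoC P0 P1 Pdev; split=> l k.
(* Extension by 0 to all of [nat], the form in which exponents and values are indexed in
   [cvg_cycle_statistic]. *)
all: pose k' a := if insub a is Some i then k i else 0%N.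
all: have kE (a : 'I_l) : k a = k' a by rewrite /k' valK.
  rewrite (eq_bigr (fun a : 'I_l => poisson_moment (c_rho rho a.+1) (k' a)));
  last by move=> a _; rewrite kE.
  have -> : (fun n => \sum_(s : {perm 'I_n}) P n s * \prod_(a < l) (ncycles s a.+1)%:R ^+ k a) =
      (fun n => \sum_(s : {perm 'I_n}) P n s * \prod_(a < l) (ncycles s a.+1)%:R ^+ k' a).
    by apply/funext => n; apply: eq_bigr => s _; congr (_ * _); apply: eq_bigr => a _; rewrite kE.
  apply: (@cvg_cycle_statistic R rho P rhoC P0 P1 Pdev l (fun a x => x%:R ^+ k' a)
    (fun a => poisson_moment (c_rho rho a.+1) (k' a))) => [a x|a]; first exact: exprn_ge0.
  by apply: transfers_moment; exact: c_rho_gt0.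
rewrite (eq_bigr (fun a : 'I_l => poisson_pmf (c_rho rho a.+1) (k' a)));
  last by move=> a _; rewrite kE.
(* The joint event becomes a product of indicators, one per coordinate, each handled by
   [transfers_pmf]. *)
have -> : (fun n => \sum_(s : {perm 'I_n} | [forall a : 'I_l, ncycles s a.+1 == k a]) P n s) =
    (fun n => \sum_(s : {perm 'I_n}) P n s * \prod_(a < l) (ncycles s a.+1 == k' a)%:R).
  apply/funext => n; rewrite big_mkcond; apply: eq_bigr => s _.
  case: forallP => [H|/forallP]; first by rewrite big1 ?mulr1// => a _; rewrite -kE H.
  rewrite negb_forall => /existsP[a]; rewrite kE => /negbTE ka.
  by rewrite (bigD1 a)//= ka mul0r mulr0.
apply: (@cvg_cycle_statistic R rho P rhoC P0 P1 Pdev l (fun a x => (x == k' a)%:R)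
  (fun a => poisson_pmf (c_rho rho a.+1) (k' a))) => [a x|a]; first exact: ler0n.
by apply: transfers_pmf; exact: c_rho_gt0.
Qed.
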